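(* Every null Cartan cubic $\alpha:I\to\mathbb{E}^4_1$ is simultaneously a normal helix (with Type I field $V=\lambda_0T+N$ and $\langle V,W\rangle=c_0$, where $\lambda_0,c_0\in\mathbb{R}\setminus\{0\}$ are constants), a general helix, and a slant helix with respect to the axis $$W=C_1(\kappa_2T+B_1)+\frac{c_0}{\lambda_0}B_2,\qquad C_1\in\mathbb{R}.$$
   Context: Minkowski space-time $\mathbb{E}^4_1$ is $\mathbb{R}^4$ with the metric $\langle x,y\rangle=-x_1y_1+x_2y_2+x_3y_3+x_4y_4$. A null Cartan curve is a smooth null curve $\alpha:I\to\mathbb{E}^4_1$ ($I$ an interval, $\alpha'\neq0$, $\langle\alpha',\alpha'\rangle=0$) parametrized by pseudo-arc length $s$ (so $\langle\alpha'',\alpha''\rangle=1$), together with its Cartan frame $\{T,N,B_1,B_2\}$, $T=\alpha'$, $N=\alpha''$, where $\langle T,T\rangle=\langle B_2,B_2\rangle=0$, $\langle N,N\rangle=\langle B_1,B_1\rangle=1$, $\langle T,B_2\rangle=1$, all other inner products of frame vectors vanish, $\det(T,N,B_1,B_2)=1$, and $$T'=N,\quad N'=\kappa_2B_1-B_2,\quad B_1'=\kappa_3T-\kappa_2N,\quad B_2'=-\kappa_3B_1$$ for smooth functions $\kappa_2,\kappa_3:I\to\mathbb{R}$ (the Cartan curvatures). Primes denote $d/ds$. A null Cartan cubic is a null Cartan curve with $\kappa_3\equiv0$. With respect to a fixed vector $W$ (i.e. $W'=0$), $\alpha$ is a normal helix with field $V$ (a combination of $T,N,B_1$ with constant coefficients)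 if $\langle V,W\rangle$ is constant, a general helix if $\langle T,W\rangle$ is constant, and a slant helix if $\langle N,W\rangle$ is constant.
   Formalization: Since W' = C_1 κ_2' T, the claim for arbitrary C_1 fails when κ_2 is nonconstant (e.g. κ_2(s)=s, C_1=1); what is proved is that some C_1 works for every null Cartan cubic, and that every C_1 ∈ R works when κ_2 is constant. *)

(* Defs.v *)
From HB Require Import structures.
From mathcomp Require Export all_boot all_order all_algebra.
From mathcomp Require Export all_classical all_reals all_analysis.
Export Order.TTheory GRing.Theory Num.Theory.
Export numFieldNormedType.Exports.

Set Implicit Arguments.
Unset Strict Implicit.
Unset Printing Implicit Defensive.

Local Open Scope classical_set_scope.
Local Open Scope ring_scope.

Section Calculus.
Context {R : realType} {V : normedModType R}.
Implicit Types (I : set R) (f g : R -> V).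

(* [I] need not be open: at an endpoint belonging to [I] the limit below is
   one-sided; at an interior point it is the usual derivative. *)
Definition has_derivative_on I f g : Prop :=
  forall s, I s ->
    (t - s)^-1 *: (f t - f s) @[t --> within I (dnbhs s)] --> g s.

(* [F n] is the n-th derivative of [f] on [I]. *)
Definition smooth_on I f : Prop :=
  exists F : nat -> R -> V,
    (forall s, I s -> F 0 s = f s) /\
    forall n, has_derivative_on I (F n) (F n.+1).

Definition fixed_on I f : Prop := has_derivative_on I f (fun=> 0).

End Calculus.

Section NullCartan.
Context {R : realType}.
Implicit Types (I : set R) (s : R).

Definition nondegenerate_interval I : Prop :=
  is_interval I /\ exists a b, [/\ I a, I b & a < b].

(* Coordinates are numbered from 0, so the time coordinate x_1 is [x 0 0]. *)
Definition minkowski (x y : 'rV[R]_4) : R :=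
  - (x 0 0 * y 0 0) + x 0 1 * y 0 1 + x 0 2 * y 0 2 + x 0 3 * y 0 3.

(* [T] and [N] stand for alpha' and alpha''. *)
Record null_cartan_curve I (alpha T N B1 B2 : R -> 'rV[R]_4)
    (k2 k3 : R -> R) : Prop := NullCartanCurve {
  curve_smooth : smooth_on I alpha;
  k2_smooth : smooth_on I (k2 : R -> R^o);
  k3_smooth : smooth_on I (k3 : R -> R^o);
  curve_deriv : has_derivative_on I alpha T;
  curve_regular : forall s, I s -> T s != 0;
  frame_TT : forall s, I s -> minkowski (T s) (T s) = 0;
  frame_NN : forall s, I s -> minkowski (N s) (N s) = 1;
  frame_B1B1 : forall s, I s -> minkowski (B1 s) (B1 s) = 1;
  frame_B2B2 : forall s, I s -> minkowski (B2 s) (B2 s) = 0;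
  frame_TB2 : forall s, I s -> minkowski (T s) (B2 s) = 1;
  frame_TN : forall s, I s -> minkowski (T s) (N s) = 0;
  frame_TB1 : forall s, I s -> minkowski (T s) (B1 s) = 0;
  frame_NB1 : forall s, I s -> minkowski (N s) (B1 s) = 0;
  frame_NB2 : forall s, I s -> minkowski (N s) (B2 s) = 0;
  frame_B1B2 : forall s, I s -> minkowski (B1 s) (B2 s) = 0;
  frame_det : forall s, I s ->
    \det (\matrix_(i < 4) nth 0 [:: T s; N s; B1 s; B2 s] i) = 1;
  T_deriv : has_derivative_on I T N;
  N_deriv : has_derivative_on I N (fun s => k2 s *: B1 s - B2 s);
  B1_deriv : has_derivative_on I B1 (fun s => k3 s *: T s - k2 s *: N s);
  B2_deriv : has_derivative_on I B2 (fun s => - (k3 s *: B1 s))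
}.

Definition null_cartan_cubic I (alpha T N B1 B2 : R -> 'rV[R]_4)
    (k2 k3 : R -> R) : Prop :=
  null_cartan_curve I alpha T N B1 B2 k2 k3 /\ forall s, I s -> k3 s = 0.

(* In the helix predicates the axis [W] is given as a vector field along the
   curve, and being a fixed vector, W' = 0, is part of the definition. *)
Definition normal_helix I (T N B1 V W : R -> 'rV[R]_4) (c : R) : Prop :=
  [/\ fixed_on I W,
      exists l0 l1 l2 : R, forall s, I s ->
        V s = l0 *: T s + l1 *: N s + l2 *: B1 s &
      forall s, I s -> minkowski (V s) (W s) = c].

Definition general_helix I (T W : R -> 'rV[R]_4) : Prop :=
  fixed_on I W /\ exists c : R, forall s, I s -> minkowski (T s) (W s) = c.

Definition slant_helix I (N W : R -> 'rV[R]_4) : Prop :=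
  fixed_on I W /\ exists c : R, forall s, I s -> minkowski (N s) (W s) = c.

Definition typeI_field (T N : R -> 'rV[R]_4) (lambda0 : R) : R -> 'rV[R]_4 :=
  fun s => lambda0 *: T s + N s.

Definition cubic_axis (T B1 B2 : R -> 'rV[R]_4) (k2 : R -> R)
    (lambda0 c0 C1 : R) : R -> 'rV[R]_4 :=
  fun s => C1 *: (k2 s *: T s + B1 s) + (c0 / lambda0) *: B2 s.

Definition simultaneous_helix I (T N B1 W : R -> 'rV[R]_4)
    (lambda0 c0 : R) : Prop :=
  [/\ normal_helix I T N B1 (typeI_field T N lambda0) W c0,
      general_helix I T W &
      slant_helix I N W].

End NullCartan.

(* Main.v *)
Require Import Defs.
From mathcomp Require Import ring.

(** Differentiating the axis
    [W = C1 (k2 T + B1) + (c0 / lambda0) B2]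
    by the Cartan equations with [k3 = 0], the two [N]-terms [C1 k2 T'] and
    [C1 B1'] cancel, [B2' = 0], and what is left is [W' = (C1 k2)' T].  So [W]
    is a fixed vector exactly when [C1 k2] is constant along the curve; this
    holds when [C1 = 0], where the axis is a multiple of the constant null
    vector [B2], and for every [C1] when [k2] is constant.

    The inner products do not depend on [C1]: the frame relations give
    [<T, W> = c0 / lambda0] and [<N, W> = 0], so that
    [<lambda0 T + N, W> = c0].  Both claims are therefore instances of
    [simultaneous_helix_cubic_axis]. *)

Local Open Scope classical_set_scope.
Local Open Scope ring_scope.

Section DerivativeOn.
Context {R : realType} {V : normedModType R}.
Implicit Types (I : set R) (f g : R -> V).

Lemma has_derivative_onD {I f f' g g'} :
  has_derivative_on I f f' -> has_derivative_on I g g' ->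
  has_derivative_on I (fun s => f s + g s) (fun s => f' s + g' s).
Proof.
move=> df dg s Is.
under eq_fun do rewrite opprD addrACA scalerDr.
by apply: cvgD; [exact: df|exact: dg].
Qed.

Lemma has_derivative_onZ {I} (a : R) {f f'} :
  has_derivative_on I f f' ->
  has_derivative_on I (fun s => a *: f s) (fun s => a *: f' s).
Proof.
move=> df s Is.
under eq_fun do rewrite -scalerBr scalerA mulrC -scalerA.
by apply: cvgZ; [exact: cvg_cst|exact: df].
Qed.

(** A derivative at [s] only sees the values of the function on [I], so the
    comparison function [g] may be chosen anew at each [s]. *)
Lemma has_derivative_on_local {I f f'} :
  (forall s, I s -> exists g g', [/\ has_derivative_on I g g',
     forall t, I t -> f t = g t & f' s = g' s]) ->
  has_derivative_on I f f'.
Proof.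
move=> loc s Is; have [g [g' [dg fg ->]]] := loc s Is.
apply: cvg_trans (dg s Is); apply: near_eq_cvg.
apply: filterS (withinT _ _) => t It /=.
by rewrite !fg.
Qed.

End DerivativeOn.

Section Minkowski.
Context {R : realType}.
Implicit Types x y z : 'rV[R]_4.

Lemma minkowskiC x y : minkowski x y = minkowski y x.
Proof. by rewrite /minkowski; ring. Qed.

Lemma minkowskiDr x y z : minkowski x (y + z) = minkowski x y + minkowski x z.
Proof. by rewrite /minkowski !mxE; ring. Qed.

Lemma minkowskiZr (a : R) x y : minkowski x (a *: y) = a * minkowski x y.
Proof. by rewrite /minkowski !mxE; ring. Qed.

Lemma minkowskiDl x y z : minkowski (x + y) z = minkowski x z + minkowski y z.
Proof. by rewrite minkowskiC minkowskiDr !(minkowskiC z). Qed.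

Lemma minkowskiZl (a : R) x y : minkowski (a *: x) y = a * minkowski x y.
Proof. by rewrite minkowskiC minkowskiZr minkowskiC. Qed.

End Minkowski.

Section CubicAxis.
Context {R : realType} {I : set R}.
Context {alpha T N B1 B2 : R -> 'rV[R]_4} {k2 k3 : R -> R} {lambda0 c0 C1 : R}.

Local Notation W := (cubic_axis T B1 B2 k2 lambda0 c0 C1).

Lemma minkowski_T_axis {s} : null_cartan_curve I alpha T N B1 B2 k2 k3 ->
  I s -> minkowski (T s) (W s) = c0 / lambda0.
Proof.
move=> hc Is; rewrite !(minkowskiDr, minkowskiZr).
by rewrite (frame_TT hc) ?(frame_TB1 hc) ?(frame_TB2 hc) //; ring.
Qed.

Lemma minkowski_N_axis {s} : null_cartan_curve I alpha T N B1 B2 k2 k3 ->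
  I s -> minkowski (N s) (W s) = 0.
Proof.
move=> hc Is; rewrite !(minkowskiDr, minkowskiZr) (minkowskiC (N s) (T s)).
by rewrite (frame_TN hc) ?(frame_NB1 hc) ?(frame_NB2 hc) //; ring.
Qed.

(** On [I] the coefficient [C1 k2] of [T] agrees with its value at the point
    of differentiation.  This turns [W] into a combination of [T], [B1], [B2]
    with constant coefficients, to which linearity of the derivative applies;
    the [N]-components [C1 k2] and [- C1 k2] of that derivative cancel. *)
Lemma cubic_axis_fixed : null_cartan_cubic I alpha T N B1 B2 k2 k3 ->
  (forall s t, I s -> I t -> C1 * k2 s = C1 * k2 t) -> fixed_on I W.
Proof.
move=> [hc k30] C1k2; apply: has_derivative_on_local => s Is.
pose a := C1 * k2 s.
have dW := has_derivative_onD (has_derivative_onD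
  (has_derivative_onZ a (T_deriv hc)) (has_derivative_onZ C1 (B1_deriv hc)))
  (has_derivative_onZ (c0 / lambda0) (B2_deriv hc)).
eexists; eexists; split; first exact: dW.
  by move=> t It; rewrite /cubic_axis scalerDr scalerA (C1k2 t s).
by rewrite /= k30 // !scale0r sub0r oppr0 scaler0 addr0 scalerN scalerA subrr.
Qed.

Lemma simultaneous_helix_cubic_axis : lambda0 != 0 ->
  null_cartan_cubic I alpha T N B1 B2 k2 k3 ->
  (forall s t, I s -> I t -> C1 * k2 s = C1 * k2 t) ->
  simultaneous_helix I T N B1 W lambda0 c0.
Proof.
move=> l0 hcubic C1k2; have hc := hcubic.1.
have fixW := cubic_axis_fixed hcubic C1k2.
split; split=> //.
- by exists lambda0, 1, 0 => s _; rewrite scale1r scale0r addr0.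
- move=> s Is; rewrite minkowskiDl minkowskiZl.
  by rewrite minkowski_T_axis// minkowski_N_axis// addr0 mulrC divfK.
- by exists (c0 / lambda0) => s; exact: minkowski_T_axis.
- by exists 0 => s; exact: minkowski_N_axis.
Qed.

End CubicAxis.

Theorem corollary2 (R : realType) (I : set R)
    (alpha T N B1 B2 : R -> 'rV[R]_4) (k2 k3 : R -> R) (lambda0 c0 : R)
    (hI : nondegenerate_interval I)
    (hcubic : null_cartan_cubic I alpha T N B1 B2 k2 k3)
    (hlambda0 : lambda0 != 0) (hc0 : c0 != 0) :
  (exists C1 : R,
     simultaneous_helix I T N B1 (cubic_axis T B1 B2 k2 lambda0 c0 C1)
       lambda0 c0) /\
  ((forall s t, I s -> I t -> k2 s = k2 t) ->
   forall C1 : R,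
     simultaneous_helix I T N B1 (cubic_axis T B1 B2 k2 lambda0 c0 C1)
       lambda0 c0).
Proof.
split=> [|k2_cst C1].
  exists 0; apply: simultaneous_helix_cubic_axis hcubic _ => // s t _ _.
  by rewrite !mul0r.
apply: simultaneous_helix_cubic_axis hcubic _ => // s t Is It.
by rewrite (k2_cst s t).
Qed.
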